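(* For any natural number $N$ and any positive integer $n$, \begin{equation*} \mathrm{spt}(n, N) = \frac{1}{2}\left(M_{2,N}(n)- N_{2,N}(n)\right), \end{equation*} equivalently, \begin{equation*} \mathrm{spt}(n, N) = \sum_{j=0}^{n-1}p(j, N)\sigma(n-j, N)-\frac{1}{2}N_{2,N}(n),\qquad \sigma(k, N)=\sum_{d\mid k,\ d\geq k/N}d. \end{equation*}
   Context: For a partition $\pi$: $|\pi|$ is its sum, $l(\pi)$ its largest part, $\#(\pi)$ its number of parts, $\mathrm{rank}(\pi)=l(\pi)-\#(\pi)$. $p(n,N)$ is the number of partitions of $n$ with largest part $\leq N$ ($p(0,N)=1$). $\mathrm{spt}(n,N)$ is the total number of occurrences of the smallest part, summed over all partitions of $n$ with largest part $\leq N$. Finite rank counts: for $1\leq j\leq N$, consider pairs $(\pi_1,\pi_2)$ with $\pi_1$ a partition into distinct parts, empty or with all parts in $[N-j+1,N]$, and $\pi_2$ a partition with Durfee square of size $j$; weight $(-1)^{\#(\pi_1)}$, size $|\pi_1|+|\pi_2|$, rank $\mathrm{rank}(\pi_2)$. $N_{S_1}(m,n)$ is the sum over $j=1,\dots,N$ of the weighted count of such pairs of size $n$ and rank $m$. Finite crank counts: $M_{S_2}(m,n)$ is the sum of $(-1)^{\#(\pi_1)}$ over triples $(\pi_1,\pi_2,\pi_3)$ with $\pi_1$ into distinct parts, $\pi_2,\pi_3$ arbitrary partitions, all largest parts $\leq N$, $|\pi_1|+|\pi_2|+|\pi_3|=n$ and $\#(\pi_2)-\#(\pi_3)=m$. Moments: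 $N_{k,N}(n)=\sum_{m\in\mathbb{Z}} m^kN_{S_1}(m,n)$ and $M_{k,N}(n)=\sum_{m\in\mathbb{Z}}m^kM_{S_2}(m,n)$. *)

(* Defs.v *)
From mathcomp Require Import all_boot all_order all_algebra finmap.
From mathcomp Require Import mathcomp_extra boolp classical_sets functions.
From mathcomp Require Import cardinality fsbigop.
Set Implicit Arguments.
Unset Strict Implicit.
Unset Printing Implicit Defensive.
Import Order.TTheory GRing.Theory Num.Theory.
Local Open Scope classical_set_scope.
Local Open Scope ring_scope.

(* A partition is the weakly decreasing list of its positive parts.  Its sum  *)
(* is [sumn pi] and its number of parts is [size pi].                         *)
Definition is_partition (pi : seq nat) : bool :=
  sorted geq pi && (0%N \notin pi).

Definition largest (pi : seq nat) : nat := head 0%N pi.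

Definition smallest (pi : seq nat) : nat := last 0%N pi.

Definition rank (pi : seq nat) : int := (largest pi)%:Z - (size pi)%:Z.

(* The largest j such that at least j parts are >= j. *)
Definition durfee (pi : seq nat) : nat :=
  (\max_(j < (size pi).+1 | j <= count (fun a => j <= a) pi) j)%N.

Definition partitions_le (n N : nat) : set (seq nat) :=
  [set pi | [&& is_partition pi, sumn pi == n & (largest pi <= N)%N]].

Definition num_part (n N : nat) : nat := #|` fset_set (partitions_le n N)|.

Definition spt (n N : nat) : nat :=
  \sum_(pi \in partitions_le n N) count_mem (smallest pi) pi.

Definition S1 (N j : nat) (m : int) (n : nat) : set (seq nat * seq nat) :=
  [set x | [/\ is_partition x.1, uniq x.1 & all (fun a => N - j < a <= N)%N x.1]
        /\ [/\ is_partition x.2, durfee x.2 = j,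
               (sumn x.1 + sumn x.2)%N = n & rank x.2 = m]].

Definition N_S1 (N : nat) (m : int) (n : nat) : int :=
  \sum_(1 <= j < N.+1) \sum_(x \in S1 N j m n) (-1 : int) ^+ size x.1.

Definition S2 (N : nat) (m : int) (n : nat) : set (seq nat * seq nat * seq nat) :=
  [set x | let: (pi1, pi2, pi3) := x in
    [/\ is_partition pi1, uniq pi1, is_partition pi2 & is_partition pi3] /\
    [/\ (largest pi1 <= N)%N, (largest pi2 <= N)%N & (largest pi3 <= N)%N] /\
    (sumn pi1 + sumn pi2 + sumn pi3)%N = n /\
    (size pi2)%:Z - (size pi3)%:Z = m].

Definition M_S2 (N : nat) (m : int) (n : nat) : int :=
  \sum_(x \in S2 N m n) (-1 : int) ^+ size x.1.1.

Definition rank_moment (k N n : nat) : int :=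
  \sum_(m \in [set: int]) m ^+ k * N_S1 N m n.

Definition crank_moment (k N n : nat) : int :=
  \sum_(m \in [set: int]) m ^+ k * M_S2 N m n.

(* The condition d >= k / N is cleared of its denominator. *)
Definition sigma (k N : nat) : nat :=
  (\sum_(d <- divisors k | k <= d * N) d)%N.

(* The set-indexed sums and the cardinal above take the value 0 when the      *)
(* index set (or the support) is infinite; the following facts show that this *)
(* never happens.                                                             *)

Lemma partition_bounds (pi : seq nat) : is_partition pi ->
  (size pi <= sumn pi)%N /\ all (fun a => a <= sumn pi)%N pi.
Proof.
case/andP=> _; elim: pi => //= a s IH; rewrite inE negb_or => /andP[a0 /IH[h1 h2]].
rewrite leq_addr; split; first by rewrite -add1n leq_add // lt0n eq_sym.
by apply: sub_all h2 => b /leq_trans; apply; rewrite leq_addl.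
Qed.

Lemma finite_partitions_sumn_le (n : nat) :
  finite_set [set pi | is_partition pi && (sumn pi <= n)%N].
Proof.
pose f (t : {k : 'I_n.+1 & (val k).-tuple 'I_n.+1}) : seq nat :=
  [seq val i | i <- tagged t].
apply: (@sub_finite_set _ _ (f @` setT)); last exact/finite_image/finite_finset.
move=> pi /= /andP[/partition_bounds[hs ha] hn].
have hk : (size pi < n.+1)%N by rewrite ltnS (leq_trans hs).
have ht : size [seq inord a : 'I_n.+1 | a <- pi] == val (Ordinal hk).
  by rewrite size_map.
exists (Tagged (fun k : 'I_n.+1 => (val k).-tuple 'I_n.+1) (Tuple ht)) => //.
rewrite /f /= -map_comp -[RHS]map_id; apply/eq_in_map => a /(allP ha) h /=.
by rewrite inordK // ltnS (leq_trans h).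
Qed.

Lemma finite_partitions_le (n N : nat) : finite_set (partitions_le n N).
Proof.
apply: sub_finite_set (finite_partitions_sumn_le n) => pi /= /and3P[-> /eqP -> _].
by rewrite leqnn.
Qed.

Lemma finite_S1_all (N j n : nat) : finite_set (\bigcup_m S1 N j m n).
Proof.
have h := finite_partitions_sumn_le n.
apply: sub_finite_set (finite_setX h h) => -[a b] [m _] /=.
by case=> -[/= -> _ _] [-> _ <- _]; rewrite leq_addr leq_addl.
Qed.

Lemma finite_S1 (N j : nat) (m : int) (n : nat) : finite_set (S1 N j m n).
Proof. by apply: sub_finite_set (finite_S1_all N j n) => x hx; exists m. Qed.

Lemma finite_S2_all (N n : nat) : finite_set (\bigcup_m S2 N m n).
Proof.
have h := finite_partitions_sumn_le n.
apply: sub_finite_set (finite_setX (finite_setX h h) h) => -[[a b] c] [m _] /=.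
case=> -[-> _ -> ->] [_ [<- _]] /=; split; last exact: leq_addl.
by rewrite -addnA leq_addr addnCA leq_addr.
Qed.

Lemma finite_S2 (N : nat) (m : int) (n : nat) : finite_set (S2 N m n).
Proof. by apply: sub_finite_set (finite_S2_all N n) => x hx; exists m. Qed.

Lemma finite_supp_N_S1 (N n : nat) : finite_set [set m | N_S1 N m n != 0].
Proof.
apply: (@sub_finite_set _ _ (\bigcup_(j in `I_N.+1)
    (fun x => rank x.2) @` (\bigcup_m S1 N j m n))); last first.
  apply: bigcup_finite => [|j _]; first exact: finite_II.
  exact/finite_image/finite_S1_all.
move=> m /= hm; apply: contrapT => hn; case/negP: hm; apply/eqP.
rewrite /N_S1 big_nat; apply: big1 => j /andP[_ jN]; apply: fsbig1 => x hx.
case: hn; exists j => //; exists x; first by exists m.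
by case: hx => _ [].
Qed.

Lemma finite_supp_M_S2 (N n : nat) : finite_set [set m | M_S2 N m n != 0].
Proof.
apply: (@sub_finite_set _ _
    ((fun x => (size x.1.2)%:Z - (size x.2)%:Z) @` (\bigcup_m S2 N m n))); last first.
  exact/finite_image/finite_S2_all.
move=> m /= hm; apply: contrapT => hn; case/negP: hm; apply/eqP.
apply: fsbig1 => x hx; case: hn; exists x; first by exists m.
by case: x hx => [[a b] c] [_ [_ []]].
Qed.

(* Main.v *)
Require Import Defs.
From HB Require Import structures.
From mathcomp Require Import all_boot all_order all_algebra finmap.
From mathcomp Require Import mathcomp_extra boolp classical_sets functions.
From mathcomp Require Import cardinality fsbigop zify ring.
Set Implicit Arguments.
Unset Strict Implicit.
Unset Printing Implicit Defensive.
Import Order.TTheory GRing.Theory Num.Theory.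
Local Open Scope classical_set_scope.
Local Open Scope ring_scope.

(** Write (q)_n = (1-q)...(1-q^n), A_i = q^i/(1-q^i)^2 and H_j = A_1+...+A_j.
    Adding copies of the part N to partitions with smaller parts gives the
    generating functions
      sum_n spt(n,N) q^n      = sum_(i<=N) A_i (q)_i / (q)_N,
      1/2 sum_n M_{2,N}(n) q^n = H_N / (q)_N,
      1/2 sum_n N_{2,N}(n) q^n = sum_(j<=N) (q)_N q^(j^2) H_j
                                            / ((q)_(N-j) (q)_j^2);
    the last one splits a partition along its Durfee square, so that the rank
    becomes the difference of two independent copies of the same statistic.
    With c(N,j) = (q)_N^2 q^(j^2) / ((q)_(N-j) (q)_j^2), multiplication by (q)_N
    turns the theorem into F(N) - F(N-1) = A_N (1 - (q)_N) for
    F(N) = sum_j c(N,j) H_j.  The sums sum_j c(N,j) = 1 have a WZ mate G, and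
    summation by parts gives F(N) - F(N-1) = sum_i A_i G(N,i).  The identity
    A_i G(N,i) = A_N c(N,i) then concludes, as sum_(i>=1) c(N,i) = 1 - (q)_N. *)

(** * The q-series identity *)

Section QIdentity.
Variables (R : comNzRingType) (x : R) (u : nat -> R).
(** An inverse of 1 - x^i is posited only for positive i, because 1 - x^0 is zero; the value [u 0]
    is arbitrary. *)
Hypothesis uP : forall i, (1 - x ^+ i.+1) * u i.+1 = 1.

Definition qpoch n : R := \prod_(i < n) (1 - x ^+ i.+1).
Definition inv_qpoch n : R := \prod_(i < n) u i.+1.
Definition lambert i : R := x ^+ i * u i ^+ 2.
Definition lambert_sum n : R := \sum_(i < n) lambert i.+1.
(** These are the c(n, j) of the overview; [lambert] and [lambert_sum] are its A_i and H_j. *)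
Definition wt n j : R :=
  qpoch n ^+ 2 * inv_qpoch (n - j) * x ^+ (j ^ 2) * inv_qpoch j ^+ 2.
(* The WZ mate of [wt], see [wt_diff]. *)
Definition wt_mate n j : R :=
  x ^+ (n.+1 - j + j ^ 2) * qpoch n ^+ 2 * inv_qpoch (n.+1 - j)
  * inv_qpoch j ^+ 2 * (1 - x ^+ j) ^+ 2.

Lemma qpochS n : qpoch n.+1 = qpoch n * (1 - x ^+ n.+1).
Proof. by rewrite /qpoch big_ord_recr. Qed.

Lemma inv_qpochS n : inv_qpoch n.+1 = inv_qpoch n * u n.+1.
Proof. by rewrite /inv_qpoch big_ord_recr. Qed.

Lemma lambert_sumS n : lambert_sum n.+1 = lambert_sum n + lambert n.+1.
Proof. by rewrite /lambert_sum big_ord_recr. Qed.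

Lemma qpochK n : qpoch n * inv_qpoch n = 1.
Proof.
by rewrite /qpoch /inv_qpoch -big_split /= big1 // => i _; rewrite uP.
Qed.

Lemma inv_qpoch_pred n : inv_qpoch n = inv_qpoch n.+1 * (1 - x ^+ n.+1).
Proof. by rewrite inv_qpochS -mulrA [u _ * _]mulrC uP mulr1. Qed.

(** Over the common denominators [inv_qpoch d.+1] and [inv_qpoch j.+1], with d = n - j, this is a
    polynomial identity in x, x^j and x^d. *)
Lemma wt_diff n j : (j <= n)%N ->
  wt n.+1 j - wt n j = wt_mate n j - wt_mate n j.+1.
Proof.
move=> jn; rewrite /wt /wt_mate qpochS subSS subSn //.
move: (subnK jn); set d := (n - j)%N => dj.
rewrite [inv_qpoch d]inv_qpoch_pred [inv_qpoch j]inv_qpoch_pred.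
have -> : (j.+1 ^ 2 = j ^ 2 + (j + j.+1))%N by rewrite -!mulnn; ring.
have -> : x ^+ n.+1 = x ^+ d.+1 * x ^+ j by rewrite -exprD addSn dj.
have xS i : x ^+ i.+1 = x * x ^+ i by rewrite exprS.
rewrite !exprD [x ^+ j.+1]xS [x ^+ d.+1]xS.
move: (x ^+ j) (x ^+ d) (x ^+ (j ^ 2)) (qpoch n) => a b c e.
move: (inv_qpoch d.+1) (inv_qpoch j.+1) => f g; ring.
Qed.

(** This replaces [wt_diff] at j = n+1, where truncated subtraction keeps [wt n j] from being the
    expected zero. *)
Lemma wt_mate_last n : wt_mate n n.+1 = wt n.+1 n.+1.
Proof. rewrite /wt_mate /wt subnn add0n qpochS.
move: (x ^+ (n.+1 ^ 2)) (x ^+ n.+1) => a b; ring. Qed.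

Lemma sum_wt_diff n (h : nat -> R) :
  \sum_(j < n.+2) wt n.+1 j * h j - \sum_(j < n.+1) wt n j * h j =
  \sum_(j < n.+1) wt_mate n j.+1 * (h j.+1 - h j).
Proof.
rewrite big_ord_recr /= -wt_mate_last.
have -> : \sum_(j < n.+1) wt n.+1 j * h j = \sum_(j < n.+1) wt n j * h j
  + \sum_(j < n.+1) (wt_mate n j - wt_mate n j.+1) * h j.
  rewrite -big_split; apply: eq_bigr => j _ /=.
  have /eqP := @wt_diff n j (ltn_ord j).
  by rewrite subr_eq => /eqP ->; rewrite mulrDl addrC.
(* Summation by parts. The boundary term at j = 0 vanishes through the factor (1 - x^0)^2 of the
   mate. *)
have telescope m : \sum_(j < m) (wt_mate n j - wt_mate n j.+1) * h j
  + wt_mate n m * h m = \sum_(j < m) wt_mate n j.+1 * (h j.+1 - h j).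
  elim: m => [|m IH]; last first.
    rewrite !big_ord_recr /= -IH.
    move: (\sum_(j < m) _) (wt_mate n m) (wt_mate n m.+1) (h m) (h m.+1).
    by move=> a b c d e; ring.
  by rewrite !big_ord0 /wt_mate expr0 subrr expr0n !mulr0 mul0r addr0.
by rewrite -telescope [LHS]addrC -addrA addKr.
Qed.

(** A constant [h] kills the right side of [sum_wt_diff], so the sum is the same for every n. *)
Lemma sum_wt n : \sum_(j < n.+1) wt n j = 1.
Proof.
elim: n => [|n IH].
  by rewrite big_ord1 /wt /qpoch /inv_qpoch !big_ord0 !expr1n expr0 !mulr1.
have := sum_wt_diff n (fun=> 1).
rewrite [RHS]big1 => [|j _]; last by rewrite subrr mulr0.
move/eqP; rewrite subr_eq0 => /eqP.
by under eq_bigr do rewrite mulr1; under [RHS]eq_bigr do rewrite mulr1; rewrite IH.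
Qed.

(** The factor (1 - x^(j+1))^2 of the mate cancels the denominator of [lambert j.+1], just as the
    new factor of [qpoch n.+1 ^+ 2] cancels that of [lambert n.+1]. The remaining powers of x agree
    since (n-j) + (j+1) = n+1. *)
Lemma wt_mate_lambert n j : (j <= n)%N ->
  wt_mate n j.+1 * lambert j.+1 = lambert n.+1 * wt n.+1 j.+1.
Proof.
move=> jn; rewrite /wt_mate /lambert /wt qpochS subSS.
have -> : x ^+ (n - j + j.+1 ^ 2) * qpoch n ^+ 2 * inv_qpoch (n - j) *
    inv_qpoch j.+1 ^+ 2 * (1 - x ^+ j.+1) ^+ 2 * (x ^+ j.+1 * u j.+1 ^+ 2) =
    x ^+ (n - j + j.+1) * x ^+ (j.+1 ^ 2) * qpoch n ^+ 2 * inv_qpoch (n - j)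
    * inv_qpoch j.+1 ^+ 2 * ((1 - x ^+ j.+1) * u j.+1) ^+ 2.
  rewrite !exprD.
  move: (x ^+ (j.+1 ^ 2)) (x ^+ j.+1) (x ^+ (n - j)) (qpoch n) => a b c d.
  by move: (inv_qpoch (n - j)) (inv_qpoch j.+1) (u j.+1) => e f g; ring.
rewrite uP addnS subnK //.
have -> : x ^+ n.+1 * u n.+1 ^+ 2 * ((qpoch n * (1 - x ^+ n.+1)) ^+ 2
  * inv_qpoch (n - j) * x ^+ (j.+1 ^ 2) * inv_qpoch j.+1 ^+ 2) =
  x ^+ n.+1 * x ^+ (j.+1 ^ 2) * qpoch n ^+ 2 * inv_qpoch (n - j)
    * inv_qpoch j.+1 ^+ 2 * ((1 - x ^+ n.+1) * u n.+1) ^+ 2.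
  move: (x ^+ (j.+1 ^ 2)) (x ^+ n.+1) (qpoch n) => a b c.
  by move: (inv_qpoch (n - j)) (inv_qpoch j.+1) (u n.+1) => d e f; ring.
by rewrite uP.
Qed.

Lemma sum_wt_lambert_diff n :
  \sum_(j < n.+2) wt n.+1 j * lambert_sum j
  - \sum_(j < n.+1) wt n j * lambert_sum j =
  lambert n.+1 * (1 - qpoch n.+1).
Proof.
rewrite sum_wt_diff.
under eq_bigr => j _.
  rewrite lambert_sumS (addrC (lambert_sum _)) addrK.
  rewrite (@wt_mate_lambert n j (ltn_ord j)); over.
rewrite -mulr_sumr; congr (_ * _).
(* What is left is the sum of the weights without its term at j = 0, and that term is
   [qpoch n.+1]. *)
have := sum_wt n.+1; rewrite big_ord_recl => <-.
have -> : wt n.+1 (@ord0 n.+1) = qpoch n.+1.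
  rewrite /wt /= subn0 expr2 -!mulrA [_ * (inv_qpoch _ * _)]mulrA qpochK.
  by rewrite /inv_qpoch big_ord0 expr1n expr0 !mulr1.
by rewrite addrC addKr.
Qed.

(** The recursion assumed of [s] is the one obeyed by the generating function of spt. After
    multiplication by [qpoch n], both sides grow by [qpoch n.+1 * lambert n.+1] from n to n+1. *)
Lemma spt_rank_identity (s : nat -> R) :
    s 0 = 0 -> (forall n, s n.+1 = u n.+1 * s n + lambert n.+1) ->
  forall n, s n = inv_qpoch n * lambert_sum n -
    \sum_(j < n.+1) qpoch n * inv_qpoch (n - j) * x ^+ (j ^ 2)
                    * (inv_qpoch j ^+ 2 * lambert_sum j).
Proof.
move=> s0 sS n.
have qs : qpoch n * s n =
    lambert_sum n - \sum_(j < n.+1) wt n j * lambert_sum j.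
  elim: n => [|n IH].
    by rewrite big_ord1 s0 /lambert_sum big_ord0 !mulr0 subrr.
  have /eqP := sum_wt_lambert_diff n.
  rewrite subr_eq => /eqP ->; rewrite lambert_sumS sS qpochS.
  transitivity (((1 - x ^+ n.+1) * u n.+1) * (qpoch n * s n)
    + qpoch n * (1 - x ^+ n.+1) * lambert n.+1).
    by move: (x ^+ n.+1) (lambert n.+1) => a b; ring.
  rewrite uP IH; move: (x ^+ n.+1) (lambert n.+1) => a b.
  by move: (\sum_(j < n.+1) _) (lambert_sum n) => c d; ring.
rewrite -[LHS]mul1r -(qpochK n) [qpoch n * _]mulrC -mulrA qs mulrBr; congr (_ - _).
rewrite mulr_sumr; apply: eq_bigr => j _; rewrite /wt expr2.
transitivity ((qpoch n * inv_qpoch n) * (qpoch n * inv_qpoch (n - j)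
  * x ^+ (j ^ 2) * (inv_qpoch j ^+ 2 * lambert_sum j))).
  move: (x ^+ (j ^ 2)) (qpoch n) (inv_qpoch n) (inv_qpoch (n - j)) => a b c d.
  by move: (inv_qpoch j) (lambert_sum j) => e f; ring.
by rewrite qpochK mul1r.
Qed.

End QIdentity.

(** * Power series and generating functions *)

(** Formal power series over the integers, as a type of their own whose product is the Cauchy
    product. *)
Definition fps : Type := nat -> int.

HB.instance Definition _ := GRing.Zmodule.copy fps (nat -> int).

(** Coefficients of a product below [k] depend only on those of the factors below [k], so
    commutativity and associativity are inherited from polynomials. *)
Definition fps_trunc (k : nat) (f : fps) : {poly int} := \poly_(i < k) f i.

Definition fps_one : fps := fun n => (n == 0%N)%:R.

Definition fps_mul (f g : fps) : fps :=
  fun n => \sum_(i < n.+1) f i * g (n - i)%N.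

Lemma coef_fps_trunc k f i : (i < k)%N -> (fps_trunc k f)`_i = f i.
Proof. by move=> ik; rewrite coef_poly ik. Qed.

Lemma coef_fps_truncM k f g n : (n < k)%N ->
  (fps_trunc k f * fps_trunc k g)`_n = fps_mul f g n.
Proof.
move=> nk; rewrite coefM; apply: eq_bigr => i _.
by rewrite !coef_fps_trunc //; have := ltn_ord i; lia.
Qed.

Lemma fps_mulC : commutative fps_mul.
Proof.
move=> f g; apply/funext => n.
by rewrite -!(@coef_fps_truncM n.+1) // mulrC.
Qed.

Lemma fps_mulA : associative fps_mul.
Proof.
move=> f g h; apply/funext => n.
transitivity ((fps_trunc n.+1 f * (fps_trunc n.+1 g * fps_trunc n.+1 h))`_n).
  rewrite coefM; apply: eq_bigr => i _.
  by rewrite coef_fps_trunc // coef_fps_truncM // ltnS leq_subr.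
rewrite mulrA coefM; apply: eq_bigr => i _.
by rewrite coef_fps_truncM // coef_fps_trunc // ltnS leq_subr.
Qed.

Lemma fps_mul1 : left_id fps_one fps_mul.
Proof.
move=> f; apply/funext => n.
rewrite /fps_mul big_ord_recl mul1r subn0 big1 ?addr0 // => i _.
by rewrite /fps_one mul0r.
Qed.

Lemma fps_mulDl : left_distributive fps_mul +%R.
Proof.
move=> f g h; apply/funext => n; rewrite /fps_mul -[RHS]big_split /=.
by apply: eq_bigr => i _; rewrite -mulrDl.
Qed.

Lemma fps_one_neq0 : fps_one != 0.
Proof. by apply/eqP => /(congr1 (fun f : fps => f 0%N)). Qed.

HB.instance Definition _ := GRing.Zmodule_isComNzRing.Build fps
  fps_mulA fps_mulC fps_mul1 fps_mulDl fps_one_neq0.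

Definition fpsX : fps := fun n => (n == 1%N)%:R.

Lemma coef_fpsD (f g : fps) n : (f + g) n = f n + g n.
Proof. by []. Qed.

Lemma coef_fpsN (f : fps) n : (- f) n = - f n.
Proof. by []. Qed.

Lemma coef_fpsM (f g : fps) n : (f * g) n = \sum_(i < n.+1) f i * g (n - i)%N.
Proof. by []. Qed.

Lemma coef_fpsMn (f : fps) k n : (f *+ k) n = f n *+ k.
Proof. by elim: k => // k IH; rewrite !mulrS coef_fpsD IH. Qed.

Lemma coef_fps1 n : (1 : fps) n = (n == 0%N)%:R.
Proof. by []. Qed.

Lemma coef_fps_sum I (r : seq I) (P : pred I) (F : I -> fps) n :
  (\sum_(i <- r | P i) F i) n = \sum_(i <- r | P i) F i n.
Proof. by apply: (big_morph (fun f : fps => f n)). Qed.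

Lemma coef_fpsXnM (f : fps) d n :
  (fpsX ^+ d * f) n = if (d <= n)%N then f (n - d)%N else 0.
Proof.
elim: d n => [|d IH] n; first by rewrite expr0 mul1r subn0.
have XM (g : fps) : (fpsX * g) n = if n is m.+1 then g m else 0.
  rewrite coef_fpsM /fpsX; case: n => [|n]; first by rewrite big_ord1 mul0r.
  rewrite 2!big_ord_recl /= mul0r add0r mul1r big1 => [|i _].
    by rewrite addr0 subn1.
  by rewrite mul0r.
by rewrite exprS -mulrA XM; case: n {XM} => // n; rewrite IH subSS.
Qed.

Lemma coef_fpsXn d n : (fpsX ^+ d) n = (n == d)%:R.
Proof.
rewrite -[fpsX ^+ d]mulr1 coef_fpsXnM coef_fps1.
by case: leqP => h; [congr (GRing.natmul 1 (nat_of_bool _)); lia|rewrite ltn_eqF].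
Qed.

(** Each x in [A] contributes to exactly one fiber, that of [g x], so exchanging the two finite sums
    suffices. *)
Lemma fsbig_fibers (T K : choiceType) (A : set T) (B : set K)
    (g : T -> K) (F : T -> int) :
    finite_set A -> finite_set B -> (forall x, A x -> B (g x)) ->
  \sum_(x \in A) F x = \sum_(k \in B) \sum_(x \in A `&` g @^-1` [set k]) F x.
Proof.
move=> finA finB gAB.
under [RHS]eq_fsbigr do rewrite fsbig_mkcondr.
rewrite exchange_fsbig //; apply: eq_fsbigr => x; rewrite inE => Ax.
rewrite (fsbigD1 (g x)) //; last exact: gAB.
rewrite mem_set // fsbig1 => [|k [_ /= kN]]; first by rewrite /= addr0.
by rewrite ifF //; apply/negbTE/negP; rewrite inE /= => /esym.
Qed.

(** The series of f(x) q^(w x) over x in E. A coefficient whose sum has infinite support would be 0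
    by convention, whence [finite_fibers]. *)
Definition gf (T : choiceType) (E : set T) (w : T -> nat) (f : T -> int) : fps :=
  fun n => \sum_(x \in E `&` w @^-1` [set n]) f x.

Definition tensor (V W : Type) (f : V -> int) (g : W -> int) (x : V * W) : int :=
  f x.1 * g x.2.

Definition finite_fibers (T : choiceType) (E : set T) (w : T -> nat) :=
  forall n, finite_set (E `&` w @^-1` [set n]).

Section GeneratingFunctions.
Variables (T U : choiceType).

Lemma eq_gf (E : set T) w f g : (forall x, E x -> f x = g x) ->
  gf E w f = gf E w g.
Proof.
move=> fg; apply/funext => n; apply: eq_fsbigr => x.
by rewrite inE => -[/fg].
Qed.

Lemma gfD (E : set T) w f g : finite_fibers E w ->
  gf E w (fun x => f x + g x) = gf E w f + gf E w g.
Proof. by move=> fin; apply/funext => n; exact: fsbig_split. Qed.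

Lemma gfN (E : set T) w f : finite_fibers E w ->
  gf E w (fun x => - f x) = - gf E w f.
Proof.
move=> fin; apply/funext => n; rewrite /gf coef_fpsN -[RHS]mulN1r mulr_fsumr.
by apply: eq_fsbigr => x _; rewrite mulN1r.
Qed.

Lemma gf_bij (E : set T) (E' : set U) (h : T -> U) w w' f f' :
    set_bij E E' h -> (forall x, E x -> w' (h x) = w x) ->
    (forall x, E x -> f' (h x) = f x) ->
  gf E' w' f' = gf E w f.
Proof.
case=> hE hinj hsurj hw hf; apply/funext => n.
rewrite /gf (reindex_fsbig h (E `&` w @^-1` [set n])).
  by apply: eq_fsbigr => x; rewrite inE => -[/hf].
split.
- by move=> x [Ex /= <-]; split; [exact: hE | rewrite /= hw].
- by move=> x y; rewrite !inE => -[Ex _] [Ey _]; apply: hinj; rewrite inE.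
- move=> y [E'y /= wy]; have [x Ex hxy] := hsurj _ E'y.
  by exists x => //; split => //=; rewrite -hw // hxy.
Qed.

Lemma gf_shift (E : set T) d w f :
  gf E (fun x => d + w x)%N f = fpsX ^+ d * gf E w f.
Proof.
apply/funext => n; rewrite coef_fpsXnM /gf; case: leqP => dn; last first.
  by apply: fsbig1 => x [_ /= h]; lia.
congr (bigop _ _ _); congr finite_support.
by apply/seteqP; split => x [Ex /= h]; split => //=; lia.
Qed.

Lemma gf1 (x : T) (w : T -> nat) f :
  w x = 0%N -> f x = 1 -> gf [set x] w f = 1.
Proof.
move=> wx fx; apply/funext => n; rewrite coef_fps1 /gf.
case: eqP => [->|nN0].
  have -> : [set x] `&` w @^-1` [set 0%N] = [set x].
    by apply/seteqP; split => y /= [-> //].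
  by rewrite fsbig_set1 fx.
by apply: fsbig1 => y [/= -> h]; case: nN0; rewrite -h.
Qed.

Lemma gf0 (E : set T) (w : T -> nat) f : (forall x, E x -> f x = 0) ->
  gf E w f = 0.
Proof. by move=> f0; apply/funext => n; apply: fsbig1 => x [/f0]. Qed.

Lemma finite_fibersX (E : set T) (F : set U) w v :
    finite_fibers E w -> finite_fibers F v ->
  finite_fibers (E `*` F) (fun x => w x.1 + v x.2)%N.
Proof.
move=> finE finF n.
have fin (V : choiceType) (G : set V) z : finite_fibers G z ->
    finite_set (\bigcup_(i in `I_n.+1) (G `&` z @^-1` [set i])).
  by move=> finG; apply: bigcup_finite => // ; exact: finite_II.
apply: sub_finite_set (finite_setX (fin _ _ _ finE) (fin _ _ _ finF)).
move=> [x y] [[/= Ex Fy] h]; split.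
  by exists (w x) => //=; lia.
by exists (v y) => //=; lia.
Qed.

(** Pairs of total size n are sorted by the size i of the first component, which is the Cauchy
    product. *)
Lemma gfX (E : set T) (F : set U) w v f g :
    finite_fibers E w -> finite_fibers F v ->
  gf (E `*` F) (fun x => w x.1 + v x.2)%N (tensor f g)
  = gf E w f * gf F v g.
Proof.
move=> finE finF; apply/funext => n.
rewrite coef_fpsM /gf (@fsbig_fibers _ _ _ `I_n.+1 (fun x => w x.1)); last first.
- by move=> [x y] /= [_ /= h]; lia.
- exact: finite_II.
- exact: finite_fibersX.
rewrite -fsbig_ord.
apply: eq_bigr => i _.
have -> : E `*` F `&` (fun x => w x.1 + v x.2)%N @^-1` [set n] `&`
    (fun x => w x.1) @^-1` [set (i : nat)] =
    (E `&` w @^-1` [set (i : nat)]) `*` (F `&` v @^-1` [set (n - i)%N]).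
  have := ltn_ord i => ilt.
  by apply/seteqP; split => -[x y] /= [] [] => [[Ex Fy] h1 h2|Ex h1 [Fy h2]];
    (do ?split => //); lia.
rewrite -(@pair_fsbig _ _ _ _ _ _ _ (fun x y => f x * g y)) // mulr_fsuml.
by apply: eq_fsbigr => x _; rewrite mulr_fsumr.
Qed.

End GeneratingFunctions.

(** * Geometric series and moments of the number of parts *)

Lemma finite_fibers_mul i : finite_fibers [set: nat] (muln i.+1).
Proof.
move=> n; apply: sub_finite_set (finite_II n.+1) => k [_ /= <-].
by rewrite /= ltnS; nia.
Qed.

Definition geom i (f : nat -> int) : fps := gf [set: nat] (muln i) f.

Lemma coef_geom i (g : nat -> int) n :
  geom i.+1 g n = if (i.+1 %| n)%N then g (n %/ i.+1)%N else 0.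
Proof.
rewrite /geom /gf; case: ifP => dvd.
  have -> : [set: nat] `&` muln i.+1 @^-1` [set n] = [set (n %/ i.+1)%N].
    apply/seteqP; split => k /= => [[_ <-]|->]; first by rewrite mulKn.
    by split=> //; rewrite mulnC divnK.
  by rewrite fsbig_set1.
by apply: fsbig1 => k [_ /= h]; rewrite -h dvdn_mulr in dvd.
Qed.

(** The term k = 0 is split off; [b] covers the two constant terms that occur, 0 and 1. *)
Lemma geom_rec i (f : nat -> int) (b : bool) : f 0%N = b%:R ->
  geom i.+1 f = b%:R + fpsX ^+ i.+1 * geom i.+1 (fun k => f k.+1).
Proof.
move=> f0; apply/funext => n; rewrite coef_fpsD coef_fpsXnM !coef_geom.
have -> : (b%:R : fps) n = (b && (n == 0%N))%:R by case: b {f0}.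
case: ltnP => [ni|].
  have -> : (n == 0%N) = false by case: n ni.
  rewrite andbF add0r.
  rewrite -{1 2}(subnK ni) dvdn_addl // divnDr // divnn /= addn1.
  by case: ifP.
case: n => [_|n ni]; first by rewrite dvdn0 div0n f0 andbT addr0.
by rewrite andbF addr0 gtnNdvd.
Qed.

Definition geom1 i : fps := geom i (fun=> 1).

Lemma geom1P i : (1 - fpsX ^+ i.+1) * geom1 i.+1 = 1.
Proof.
have := @geom_rec i (fun=> 1) true erefl; rewrite -/(geom1 _).
by rewrite mulrBl mul1r => {1}->; rewrite addrK.
Qed.

Local Notation qp := (qpoch fpsX).
Local Notation qv := (inv_qpoch geom1).
Local Notation lam := (lambert fpsX geom1).
Local Notation lams := (lambert_sum fpsX geom1).

Lemma geom_solve i (g c : fps) :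
  g = fpsX ^+ i.+1 * (g + c) -> g = fpsX ^+ i.+1 * c * geom1 i.+1.
Proof.
move=> h; rewrite -[LHS]mul1r -(geom1P i) mulrAC; congr (_ * _).
by rewrite mulrBl mul1r {1}h mulrDr addrAC subrr add0r.
Qed.

(** Shifting k to k+1 reproduces the series plus lower moments, here 1 and in [geom_sqr] 2k+1, and
    [geom_solve] divides by 1 - q^(i+1). *)
Lemma geom_id i : geom i.+1 Posz = lam i.+1.
Proof.
rewrite [LHS](@geom_solve i _ (geom1 i.+1)); first by rewrite /lambert expr2 mulrA.
rewrite {1}(@geom_rec i _ false) // add0r; congr (_ * _).
rewrite -gfD; last exact: finite_fibers_mul.
by apply: eq_gf => k _; rewrite -addn1 PoszD.
Qed.

Lemma geom_sqr i : geom i.+1 (fun k => k%:Z ^+ 2) =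
  fpsX ^+ i.+1 * (lam i.+1 + lam i.+1 + geom1 i.+1) * geom1 i.+1.
Proof.
apply: geom_solve; rewrite {1}(@geom_rec i _ false) // add0r; congr (_ * _).
rewrite -geom_id -!gfD; try exact: finite_fibers_mul.
by apply: eq_gf => k _; rewrite -addn1 PoszD; ring.
Qed.

(** The logarithmic derivative at z = 1 of the product of the 1/(1 - z q^i), i at most n. *)
Definition lambert0_sum n : fps :=
  \sum_(i < n) fpsX ^+ i.+1 * geom1 i.+1.

(* The objects of [E], of size [w], are generated like the partitions into    *)
(* parts at most [n], with [s] in the role of the number of parts.            *)
Definition size_moments n (T : choiceType) (E : set T) (w s : T -> nat) :=
  [/\ finite_fibers E w, gf E w (fun=> 1) = qv n,
      gf E w (fun x => (s x)%:Z) = qv n * lambert0_sum n &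
      gf E w (fun x => (s x)%:Z ^+ 2) = qv n * (lambert0_sum n ^+ 2 + lams n)].

Lemma size_moments0 (T : choiceType) (x : T) w s : w x = 0%N -> s x = 0%N ->
  size_moments 0 [set x] w s.
Proof.
move=> wx sx; rewrite /size_moments /inv_qpoch /lambert0_sum /lambert_sum !big_ord0.
split.
- by move=> n; apply: sub_finite_set (finite_set1 x) => y [].
- by rewrite gf1.
- by rewrite mulr0 gf0 // => y ->; rewrite sx.
- by rewrite expr0n /= addr0 mulr0 gf0 // => y ->; rewrite sx.
Qed.

Lemma finite_fibers_bij (T U : choiceType) (E : set T) (E' : set U) h w w' :
    set_bij E E' h -> (forall x, E x -> w' (h x) = w x) ->
  finite_fibers E w -> finite_fibers E' w'.
Proof.
case=> _ _ hsurj hw fin n; apply: sub_finite_set (finite_image h (fin n)).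
move=> y [/hsurj [x Ex <-] /= wy]; exists x => //; split => //=.
by rewrite -hw.
Qed.

(** An object of level n+1 is one of level n with k copies of the part n+1 added. The statistic
    grows by k, so the moments follow by expanding k + s and its square. *)
Lemma size_momentsS n (T U : choiceType) (E : set T) (E' : set U) h w w' s s' :
    set_bij ([set: nat] `*` E) E' h ->
    (forall k x, E x -> w' (h (k, x)) = n.+1 * k + w x)%N ->
    (forall k x, E x -> s' (h (k, x)) = k + s x)%N ->
  size_moments n E w s -> size_moments n.+1 E' w' s'.
Proof.
move=> hbij hw hs [fin m0 m1 m2].
have finX := finite_fibersX (@finite_fibers_mul n) fin.
have reind f f' : (forall k x, E x -> f' (h (k, x)) = f (k, x)) ->
    gf E' w' f' = gf ([set: nat] `*` E) (fun x => n.+1 * x.1 + w x.2)%N f.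
  by move=> hf; apply: gf_bij hbij _ _ => -[k x] [_ Ex]; [exact: hw|exact: hf].
have uE : geom1 n.+1 = 1 + fpsX ^+ n.+1 * geom1 n.+1.
  exact: (@geom_rec n (fun=> 1) true).
have LS : lambert0_sum n.+1 = lambert0_sum n + fpsX ^+ n.+1 * geom1 n.+1.
  by rewrite /lambert0_sum big_ord_recr.
rewrite /size_moments inv_qpochS LS lambert_sumS; split.
- by apply: finite_fibers_bij hbij _ finX => -[k x] [_ Ex]; exact: hw.
- rewrite (reind (tensor (fun=> 1) (fun=> 1))) => [|*]; last first.
    by rewrite /tensor mulr1.
  by rewrite gfX //; [rewrite m0 mulrC|exact: finite_fibers_mul].
- rewrite (reind (fun x => tensor Posz (fun=> 1) x
    + tensor (fun=> 1) (fun x => (s x)%:Z) x)) => [|k x Ex]; last first.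
    by rewrite hs // PoszD /tensor /=; ring.
  rewrite gfD // !gfX //; try exact: finite_fibers_mul.
  rewrite -!/(geom _ _) geom_id -/(geom1 _) m0 m1 /lambert.
  by move: (qv n) (lambert0_sum n) (geom1 n.+1) (fpsX ^+ n.+1) => *; ring.
- rewrite (reind (fun x => tensor (fun k => k%:Z ^+ 2) (fun=> 1) x
    + (tensor Posz (fun x => (s x)%:Z) x + tensor Posz (fun x => (s x)%:Z) x)
    + tensor (fun=> 1) (fun x => (s x)%:Z ^+ 2) x)) => [|k x Ex]; last first.
    by rewrite hs // PoszD /tensor /=; ring.
  rewrite !gfD // !gfX //; try exact: finite_fibers_mul.
  rewrite -!/(geom _ _) geom_id geom_sqr -/(geom1 _) m0 m1 m2 /lambert.
  move: uE; move: (geom1 n.+1) (fpsX ^+ n.+1) (qv n) (lambert0_sum n) (lams n).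
  move=> u y v l L uE.
  (* With y = q^i and u = 1/(1-y), this splits y/(1-y)^2 into y/(1-y) and its square; it turns the
     second moment of k into the increments of [lambert0_sum n ^+ 2] and [lams n]. *)
  have e : y * u ^+ 2 = y * u + y ^+ 2 * u ^+ 2.
    by rewrite expr2 {2}uE; ring.
  transitivity (u * v * (y ^+ 2 * u ^+ 2 + (y * u + y ^+ 2 * u ^+ 2)
     + y * u * l *+ 2 + l ^+ 2 + L)); first by ring.
  by rewrite -e; ring.
Qed.

(** Each second moment contributes the square of [lambert0_sum n] plus [lams n]; the cross term,
    twice the product of the first moments, removes both squares. *)
Lemma gf_diff_sqr n (T U : choiceType) (E : set T) (F : set U) w s v t :
    size_moments n E w s -> size_moments n F v t ->
  gf (E `*` F) (fun x => w x.1 + v x.2)%N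
     (fun x => ((s x.1)%:Z - (t x.2)%:Z) ^+ 2) =
  (qv n ^+ 2 * lams n) *+ 2.
Proof.
move=> [finE E0 E1 E2] [finF F0 F1 F2].
have finX := finite_fibersX finE finF.
rewrite (@eq_gf _ _ _ _ (fun x => tensor (fun x => (s x)%:Z ^+ 2) (fun=> 1) x
    + tensor (fun=> 1) (fun x => (t x)%:Z ^+ 2) x
    + - (tensor (fun x => (s x)%:Z) (fun x => (t x)%:Z) x
    + tensor (fun x => (s x)%:Z) (fun x => (t x)%:Z) x))); last first.
  by move=> x _; rewrite /tensor; ring.
rewrite !gfD // gfN // !gfD // !gfX // E0 E1 E2 F0 F1 F2.
by move: (qv n) (lambert0_sum n) (lams n) => a b c; ring.
Qed.

(** * Partitions with bounded parts *)

Lemma sorted_geq_cat s1 s2 :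
  sorted geq (s1 ++ s2) = [&& allrel geq s1 s2, sorted geq s1 & sorted geq s2].
Proof. by rewrite !(sorted_pairwise (rev_trans leq_trans)) pairwise_cat. Qed.

Lemma sorted_geq_cons a s : sorted geq (a :: s) = all (geq a) s && sorted geq s.
Proof. by rewrite !(sorted_pairwise (rev_trans leq_trans)). Qed.

Lemma is_partition_largest N s : is_partition s && (largest s <= N)%N =
  sorted geq s && all (fun a => 0 < a <= N)%N s.
Proof.
rewrite /is_partition /largest -andbA; case: (boolP (sorted geq s)) => //= ss.
have -> : (0%N \notin s) = all (fun a => 0 < a)%N s.
  by elim: s {ss} => //= a s <-; rewrite inE negb_or eq_sym lt0n.
rewrite all_predI; congr (_ && _); case: s ss => //= a s.
rewrite -/(sorted geq (a :: s)) sorted_geq_cons => /andP[h _].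
case: leqP => //= aN; apply/esym.
by apply/allP => b /(allP h) /= ba; rewrite /= (leq_trans ba).
Qed.

Definition part_le N : set (seq nat) :=
  [set s | is_partition s && (largest s <= N)%N].

Definition push_largest N (x : nat * seq nat) := nseq x.1 N.+1 ++ x.2.

Lemma part_le0 : part_le 0 = [set [::]].
Proof.
apply/seteqP; split => s; last by move=> ->.
rewrite /part_le /mkset is_partition_largest.
by case: s => //= a s; rewrite andbC; case: a.
Qed.

Lemma push_largest_bij N :
  set_bij ([set: nat] `*` part_le N) (part_le N.+1) (push_largest N).
Proof.
split.
- move=> [k s] [_] /=; rewrite /part_le /= !is_partition_largest /push_largest /=.
  move=> /andP[ss sN]; rewrite sorted_geq_cat ss all_cat andbT.
  rewrite (sub_all _ sN) => [|a /andP[-> /leqW]//].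
  rewrite all_nseq leqnn orbT !andbT; apply/andP; split.
    apply/allrelP => a b; rewrite mem_nseq => /andP[_ /eqP ->] /(allP sN).
    by move=> /andP[_ /leqW].
  by elim: k => // k IH; rewrite /= -/(nseq _ _) -/(sorted _ (_ :: _))
    sorted_geq_cons IH andbT all_nseq /= leqnn orbT.
- move=> [k s] [l t]; rewrite !inE => -[_ /= hs] [_ /= ht].
  (* The multiplicity of [N.+1] in the glued list recovers the number of copies, since the rest
     contains none. *)
  have no (r : seq nat) : part_le N r -> count_mem N.+1 r = 0%N.
    rewrite /part_le /= is_partition_largest => /andP[_ /allP h].
    by apply/count_memPn/negP => /h; rewrite ltnn andbF.
  rewrite /push_largest /= => e; have := congr1 (count_mem N.+1) e.
  rewrite !count_cat !count_nseq !no //= eqxx !mul1n !addn0 => kl.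
  by move: e; rewrite kl => /eqP; rewrite eqseq_cat // eqxx /= => /eqP ->.
- move=> s; rewrite /part_le /= is_partition_largest.
  elim: s => [_|a s IH]; first by exists (0%N, [::]).
  rewrite sorted_geq_cons /= => /andP[/andP[sa ss] /andP[aN sN]].
  have [aE|aNE] := eqVneq a N.+1.
    have [|[k t] [_ tN] <-] := IH; first by rewrite ss.
    by exists (k.+1, t) => //; rewrite /push_largest /= aE.
  exists (0%N, a :: s) => //; split => //=.
  rewrite is_partition_largest sorted_geq_cons sa ss /=.
  have aN' : (0 < a <= N)%N by lia.
  rewrite aN' /=; apply/allP => b bs.
  by have := allP sa _ bs; have := allP sN _ bs => /=; lia.
Qed.

Lemma sumn_push_largest N k s :
  sumn (push_largest N (k, s)) = (N.+1 * k + sumn s)%N.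
Proof. by rewrite sumn_cat sumn_nseq. Qed.

Lemma part_le_moments N : size_moments N (part_le N) sumn size.
Proof.
elim: N => [|N IH]; first by rewrite part_le0; exact: size_moments0.
apply: size_momentsS (push_largest_bij N) _ _ IH => k s _.
  exact: sumn_push_largest.
by rewrite size_cat size_nseq.
Qed.

(* Partitions into at most [j] parts, padded with zeros. *)
Definition padded j : set (seq nat) := [set s | sorted geq s && (size s == j)].

(** The conjugate of [push_largest]: k becomes the smallest of the j+1 entries, the sum grows by
    (j+1)k and the largest entry by k. *)
Definition raise_all (x : nat * seq nat) := map (addn x.1) (rcons x.2 0).

Lemma sumn_map_add c s : sumn (map (addn c) s) = (size s * c + sumn s)%N.
Proof. by elim: s => //= a s ->; rewrite mulSn; lia. Qed.

Lemma sorted_geq_map_add c s : sorted geq (map (addn c) s) = sorted geq s.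
Proof.
rewrite sorted_map; apply: eq_sorted => a b /=; exact: leq_add2l.
Qed.

Lemma raise_all_bij j :
  set_bij ([set: nat] `*` padded j) (padded j.+1) raise_all.
Proof.
split.
- move=> [k s] [_ /andP[/= ss /eqP sj]]; rewrite /padded /raise_all /=.
  rewrite sorted_geq_map_add size_map size_rcons sj eqxx andbT -cats1.
  rewrite sorted_geq_cat ss !andbT.
  by apply/allrelP => a b _; rewrite inE => /eqP ->.
- move=> [k s] [l t] _ _; rewrite /raise_all /= !map_rcons !addn0 => /rcons_inj.
  by case=> e kl; move: e; rewrite kl => /(inj_map (@addnI l)) ->.
- case/lastP => [/andP[]//|s c]; rewrite /padded /= size_rcons eqSS -cats1.
  rewrite sorted_geq_cat => /andP[/and3P[/allrelP h ss _] sj].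
  have e : map (addn c) (map (subn^~ c) s) = s.
    rewrite -map_comp -[RHS]map_id; apply/eq_in_map => a /= /h ha.
    by apply: subnKC; apply: ha; rewrite inE.
  exists (c, map (subn^~ c) s); last first.
    by rewrite /raise_all /= map_rcons e addn0 cats1.
  by split => //=; rewrite size_map sj andbT -(sorted_geq_map_add c) e.
Qed.

Lemma padded_moments j : size_moments j (padded j) sumn largest.
Proof.
elim: j => [|j IH].
  suff -> : padded 0 = [set [::]] by exact: size_moments0.
  by apply/seteqP; split => s /= => [/andP[_ /nilP]|->].
apply: size_momentsS (raise_all_bij j) _ _ IH => k s /andP[_ /eqP sj].
  by rewrite /raise_all sumn_map_add size_rcons sj -cats1 sumn_cat /= !addn0.
by rewrite /raise_all /largest; case: s {sj}.
Qed.

(** * Durfee squares *)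

Definition durfee_part j : set (seq nat) :=
  [set s | is_partition s && (durfee s == j)].

(** To a j by j square, the first list is attached on the right and the second below. *)
Definition durfee_glue j (x : seq nat * seq nat) := map (addn j) x.1 ++ x.2.

Lemma sorted_geq_split a s : sorted geq s ->
  s = [seq b <- s | a <= b]%N ++ [seq b <- s | b < a]%N.
Proof.
elim: s => // b s IH; rewrite sorted_geq_cons => /andP[bs ss] /=.
case: leqP => ab /=; first by rewrite -IH.
have nil : [seq c <- s | a <= c]%N = [::].
  apply/eqP; rewrite -(negbK (_ == _)) -has_filter; apply/hasPn => c /(allP bs) /=.
  by rewrite -ltnNge => /leq_ltn_trans; apply.
by rewrite nil /= {1}(IH ss) nil.
Qed.

Lemma durfee_max s i : (i <= count (leq i) s)%N -> (i <= durfee s)%N.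
Proof.
move=> h; have is' : (i < (size s).+1)%N by rewrite ltnS (leq_trans h) ?count_size.
exact: (@leq_bigmax_cond _ _ (fun k : 'I_(size s).+1 => k : nat) (Ordinal is')).
Qed.

Lemma durfee_count s : (durfee s <= count (leq (durfee s)) s)%N.
Proof.
have [|k hk e] := @eq_bigmax_cond _
  [pred k : 'I_(size s).+1 | (k <= count (leq k) s)%N] (fun k => k : nat).
  by apply/card_gt0P; exists ord0.
by have -> : durfee s = k by exact: e.
Qed.

Lemma durfee_glueK j s t : size s = j -> all (fun a => a <= j)%N t ->
  durfee (durfee_glue j (s, t)) = j.
Proof.
move=> sj tj; apply/eqP; rewrite eqn_leq; apply/andP; split.
  apply/bigmax_leqP => i; apply: contraTT; rewrite -!ltnNge => ji.
  rewrite count_cat (_ : count _ t = 0%N) ?addn0.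
    by rewrite (leq_ltn_trans (count_size _ _)) // size_map sj.
  apply/eqP; rewrite -leqn0 leqNgt -has_count; apply/hasPn => a /(allP tj) /=.
  by rewrite -ltnNge => /leq_ltn_trans; apply.
apply: durfee_max; rewrite count_cat count_map -{1}sj.
rewrite (_ : count _ s = size s) ?leq_addr //; apply/eqP; rewrite -all_count.
by apply/allP => a _ /=; rewrite leq_addr.
Qed.

Lemma durfee_glue_bij j :
  set_bij (padded j `*` part_le j) (durfee_part j) (durfee_glue j).
Proof.
split.
- move=> [s t] [/andP[/= ss /eqP sj]]; rewrite /part_le /= is_partition_largest.
  move=> /andP[st tj].
  rewrite /durfee_part /= durfee_glueK // ?eqxx ?andbT; last first.
    by apply: sub_all tj => a /andP[].
  rewrite /is_partition sorted_geq_cat sorted_geq_map_add ss st !andbT.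
  apply/andP; split.
    apply/allrelP => _ b /mapP[a _ ->] /(allP tj) /andP[_ bj] /=.
    by rewrite (leq_trans bj) // leq_addr.
  rewrite mem_cat negb_or; apply/andP; split; last first.
    by apply/negP => /(allP tj).
  apply/negP => /mapP[a ain /esym/eqP]; rewrite addn_eq0 -sj => /andP[/nilP s0].
  by rewrite s0 in ain.
- move=> [s t] [s' t']; rewrite !inE => -[/andP[/= _ /eqP sj] _].
  move=> [/andP[/= _ /eqP sj'] _]; rewrite /durfee_glue /= => /eqP.
  rewrite eqseq_cat ?size_map ?sj ?sj' // => /andP[/eqP + /eqP ->].
  by move=> /(inj_map (@addnI j)) ->.
- move=> s /andP[/andP[ss s0] /eqP dj].
  have tk : all (leq j) (take j s).
    rewrite (sorted_geq_split j ss) takel_cat; last first.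
      by rewrite size_filter; have := durfee_count s; rewrite dj.
    by apply/allP => a /mem_take; rewrite mem_filter => /andP[].
  have dr : all (fun a => a <= j)%N (drop j s).
    (* By maximality of the Durfee square, at most j parts exceed j. *)
    have cj : (size [seq b <- s | j.+1 <= b] <= j)%N.
      rewrite size_filter leqNgt; apply/negP => /durfee_max.
      by rewrite dj ltnn.
    rewrite (sorted_geq_split j.+1 ss) drop_cat ltnNge cj /=.
    by apply/allP => a /mem_drop; rewrite mem_filter => /andP[].
  have js : size (take j s) = j.
    by rewrite size_takel // -dj (leq_trans (durfee_count _)) ?count_size.
  have e : map (addn j) (map (subn^~ j) (take j s)) = take j s.
    rewrite -map_comp -[RHS]map_id; apply/eq_in_map => a /= /(allP tk) ha.
    by rewrite subnKC.
  exists (map (subn^~ j) (take j s), drop j s); last first.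
    by rewrite /durfee_glue /= e cat_take_drop.
  split; rewrite /padded /part_le /=.
    rewrite size_map js eqxx andbT -(sorted_geq_map_add j) e.
    exact: take_sorted.
  rewrite is_partition_largest drop_sorted //=; apply/allP => a ain.
  rewrite (allP dr _ ain) andbT lt0n; apply: contraNneq s0 => <-.
  exact: mem_drop ain.
Qed.

(** The square adds j both to the largest part and to the number of parts, so the rank is
    [largest s - size t] for the two independent pieces, and [gf_diff_sqr] applies. *)
Lemma gf_durfee_rank j : (0 < j)%N ->
  gf (durfee_part j) sumn (fun s => rank s ^+ 2) =
  fpsX ^+ (j ^ 2) * ((qv j ^+ 2 * lams j) *+ 2).
Proof.
move=> j0; rewrite -(gf_diff_sqr (padded_moments j) (part_le_moments j)) -gf_shift.
apply: gf_bij (durfee_glue_bij j) _ _ => -[s t] [/andP[/= _ /eqP sj] _].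
  by rewrite /durfee_glue /= sumn_cat sumn_map_add sj -mulnn addnA.
congr (_ ^+ 2); rewrite /rank /durfee_glue /= size_cat size_map sj /largest.
case: s sj => [j0'|a s _ /=]; first by rewrite -j0' in j0.
by rewrite !PoszD; ring.
Qed.

(** * Signed partitions into distinct parts from an interval *)

Definition distinct_part lo hi : set (seq nat) :=
  [set s | [&& sorted geq s, uniq s & all (fun a => lo < a <= hi)%N s]].

Definition cons_if a (x : bool * seq nat) := if x.1 then a :: x.2 else x.2.

Lemma cons_if_bij lo hi : (lo <= hi)%N ->
  set_bij ([set: bool] `*` distinct_part lo hi) (distinct_part lo hi.+1)
          (cons_if hi.+1).
Proof.
move=> lohi; split.
- move=> [b s] [_ /and3P[/= ss us sN]]; rewrite /distinct_part /cons_if /=.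
  have sN' : all (fun a => lo < a <= hi.+1)%N s.
    by apply: sub_all sN => a /andP[-> /leqW].
  case: b => //=; last by rewrite ss us.
  rewrite -/(sorted geq (_ :: _)) sorted_geq_cons ss us sN' /= ltnS lohi leqnn.
  rewrite !andbT; apply/andP; split.
    by apply/allP => a /(allP sN) /andP[_ /leqW].
  by apply/negP => /(allP sN); rewrite ltnn andbF.
- move=> [b s] [c t]; rewrite !inE => -[_ /and3P[/= _ _ sN]] [_ /and3P[/= _ _ tN]].
  rewrite /cons_if /=; case: b; case: c => /= e; last by rewrite e.
  + by case: e => ->.
  + by move: tN; rewrite -e /= ltnn andbF.
  + by move: sN; rewrite e /= ltnn andbF.
- case=> [|a s]; first by exists (false, [::]).
  move=> /and3P[]; rewrite sorted_geq_cons /=.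
  move=> /andP[sa ss] /andP[as_ us] /andP[aN sN].
  have [aE|aNE] := eqVneq a hi.+1.
    exists (true, s); last by rewrite aE.
    split => //; rewrite /distinct_part /= ss us; apply/allP => b bs.
    have := allP sN _ bs; rewrite [(b <= _.+1)%N]leq_eqVlt.
    by case: eqP => // be; rewrite aE -be bs in as_.
  exists (false, a :: s) => //; split => //.
  rewrite /distinct_part /mkset sorted_geq_cons sa ss cons_uniq as_ us /=.
  have aN' : (lo < a <= hi)%N by lia.
  rewrite aN' /=; apply/allP => b bs.
  by have := allP sa _ bs; have := allP sN _ bs => /=; lia.
Qed.

Lemma finite_fibers_distinct lo hi : finite_fibers (distinct_part lo hi) sumn.
Proof.
move=> n; apply: sub_finite_set (finite_partitions_sumn_le n) => s.
move=> [/and3P[ss _ sN] /= <-]; rewrite leqnn andbT /is_partition ss /=.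
by apply/negP => /(allP sN).
Qed.

Lemma gf_bool_sign a :
  gf [set: bool] (fun b => b * a.+1)%N (fun b => (-1) ^+ b) = 1 - fpsX ^+ a.+1.
Proof.
apply/funext => n; rewrite coef_fpsD coef_fpsN coef_fpsXn coef_fps1 /gf.
have -> : [set: bool] `&` (fun b : bool => (b * a.+1)%N) @^-1` [set n] =
  if n == 0%N then [set false] else if n == a.+1 then [set true] else set0.
  apply/seteqP; split => -[|] /=; rewrite ?mul1n ?mul0n.
  - by move=> [_ <-] /=; rewrite eqxx.
  - by move=> [_ <-].
  - by case: eqP => //= _; case: eqP => //= ->.
  - by case: eqP => [->|_] //; case: eqP.
case: eqP => [->|_]; first by rewrite fsbig_set1 subr0.
case: eqP => _; first by rewrite fsbig_set1 sub0r.
by rewrite fsbig_set0 subr0.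
Qed.

(** Taking or omitting a part a gives a factor 1 - q^a; the product over lo < a <= lo+d is a
    quotient of two q-factorials. *)
Lemma gf_distinct lo d :
  gf (distinct_part lo (lo + d)) sumn (fun s => (-1) ^+ size s) =
  qp (lo + d) * qv lo.
Proof.
elim: d => [|d IH].
  rewrite addn0 qpochK; last exact: geom1P.
  have -> : distinct_part lo lo = [set [::]]; last by rewrite gf1.
  apply/seteqP; split => s; last by move=> ->.
  by case: s => // a s /and3P[_ _ /= /andP[]]; lia.
rewrite addnS qpochS -mulrA [(1 - _) * _]mulrC mulrA -IH mulrC -gf_bool_sign -gfX.
- apply: gf_bij (cons_if_bij (leq_addr d lo)) _ _ => -[b s] _;
    rewrite /cons_if /tensor /=.
    by case: b; rewrite ?mul1n.
  by case: b; rewrite /= ?exprS ?mul1r.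
- by move=> n; exact: finite_finset.
- exact: finite_fibers_distinct.
Qed.

(** * Multiplicity of the smallest part *)

Definition smallest_mult (s : seq nat) : int := (count_mem (Defs.smallest s) s)%:Z.

Lemma gf_indicator (T : choiceType) (E : set T) w x : E x ->
  gf E w (fun y => (y == x)%:R) = fpsX ^+ w x.
Proof.
move=> Ex; apply/funext => n; rewrite coef_fpsXn /gf.
have [->|nw] := eqVneq n (w x).
  transitivity (\sum_(y \in [set x]) ((y == x)%:R : int)).
    apply/esym/fsbig_widen => [y /= -> //|y [_ /= yx]].
    by case: eqP.
  by rewrite fsbig_set1 !eqxx.
apply: fsbig1 => y [_ /= yn]; case: eqP => // yx.
by rewrite -yx yn eqxx in nw.
Qed.

(** Copies of N+1 leave the smallest part and its multiplicity alone unless nothing lies below them;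
    then all k copies count. *)
Lemma smallest_mult_push N k s : part_le N s ->
  smallest_mult (push_largest N (k, s)) =
  smallest_mult s + k%:Z * (s == [::])%:R.
Proof.
rewrite /part_le /= is_partition_largest /smallest_mult /push_largest /Defs.smallest.
case: s => [_|a s /andP[_ sN]] /=.
  rewrite cats0 mulr1 add0r; case: k => // k.
  have -> : last 0%N (nseq k.+1 N.+1) = N.+1.
    by elim: k => // k IH; rewrite -[RHS]IH.
  by rewrite count_nseq /= eqxx mul1n.
rewrite mulr0 addr0 last_cat /= count_cat count_nseq /=.
have /(allP sN) /andP[_ h] := mem_last a s.
by rewrite [N.+1 == _]gtn_eqF.
Qed.

(** Only the empty partition occurs; its [smallest] is the default 0, which has multiplicity 0 in
    it. *)
Lemma gf_smallest0 : gf (part_le 0) sumn smallest_mult = 0.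
Proof. by rewrite part_le0; apply: gf0 => s ->. Qed.

Lemma gf_smallestS N : gf (part_le N.+1) sumn smallest_mult =
  geom1 N.+1 * gf (part_le N) sumn smallest_mult + lam N.+1.
Proof.
have [fin _ _ _] := part_le_moments N.
have finX := finite_fibersX (@finite_fibers_mul N) fin.
have finN := @finite_fibers_mul N.
rewrite (@gf_bij _ _ ([set: nat] `*` part_le N) _ (push_largest N)
  (fun x => N.+1 * x.1 + sumn x.2)%N _
  (fun x => tensor (fun=> 1) smallest_mult x
            + tensor Posz (fun s => (s == [::])%:R) x)).
- rewrite gfD // !gfX // gf_indicator; last by rewrite /part_le.
  by rewrite expr0 mulr1 -geom_id.
- exact: push_largest_bij.
- by move=> [k s] _; exact: sumn_push_largest.
- by move=> [k s] [_ hs]; rewrite smallest_mult_push // /tensor /= mul1r.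
Qed.

(** * Moments and spt as coefficients *)

Lemma partitions_le_fiber n N :
  partitions_le n N = part_le N `&` sumn @^-1` [set n].
Proof.
apply/seteqP; split => s; rewrite /partitions_le /part_le /=.
  by move=> /and3P[-> /eqP -> ->].
by move=> [/andP[-> ->] ->]; rewrite eqxx.
Qed.

Lemma coef_spt n N : (spt n N)%:Z = gf (part_le N) sumn smallest_mult n.
Proof.
rewrite /spt /gf -partitions_le_fiber !fsbig_finite; try exact: finite_partitions_le.
exact: (big_morph Posz PoszD erefl).
Qed.

Lemma coef_num_part n N : (num_part n N)%:Z = qv N n.
Proof.
have [_ <- _ _] := part_le_moments N.
rewrite /num_part /gf -partitions_le_fiber fsbig_finite.
  by rewrite big_const_seq count_predT iter_addr_0 natz.
exact: finite_partitions_le.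
Qed.

(** The involution d -> k/d of the divisors of k turns the condition [k <= d * N] into k/d <= N. *)
Lemma sum_divisors_le k N : (0 < k)%N ->
  (\sum_(i < N | i.+1 %| k) k %/ i.+1 = sigma k N)%N.
Proof.
move=> k0; rewrite /sigma.
have div2 d : (d %| k)%N -> (k %/ (k %/ d) = d)%N.
  case/dvdnP => q kE; move: k0; rewrite kE muln_gt0 => /andP[q0 d0].
  by rewrite mulnK // mulKn.
have perm : perm_eq (divisors k) (map (divn k) (divisors k)).
  apply: uniq_perm; first exact: divisors_uniq.
    rewrite map_inj_in_uniq ?divisors_uniq // => d e.
    rewrite -!dvdn_divisors // => dk ek de.
    by rewrite -(div2 d) // de div2.
  move=> d; apply/idP/mapP => [|[e]]; rewrite -!dvdn_divisors //.
    move=> dk; exists (k %/ d)%N; rewrite ?div2 // -dvdn_divisors //.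
    by rewrite dvdn_div.
  by move=> ek ->; rewrite dvdn_div.
rewrite (perm_big _ perm) big_map /=.
transitivity (\sum_(e <- [seq e <- iota 1 N | e %| k]) k %/ e)%N.
  rewrite big_filter (iotaDl 1 0 N) big_map /=.
  have -> : iota 0 N = index_iota 0 N by rewrite /index_iota subn0.
  rewrite big_mkord.
  by apply: eq_bigl => i.
rewrite (perm_big [seq e <- divisors k | e <= N]%N) /=; last first.
  apply: uniq_perm; rewrite ?filter_uniq ?iota_uniq ?divisors_uniq // => e.
  rewrite !mem_filter -dvdn_divisors // mem_iota.
  case ek: (e %| k)%N; last by rewrite andbF.
  by rewrite (dvdn_gt0 k0 ek) andbT add1n ltnS.
rewrite big_filter big_seq_cond [RHS]big_seq_cond; apply: eq_bigl => e.
case: (boolP (e \in divisors k)) => //; rewrite -dvdn_divisors // => ek.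
have e0 := dvdn_gt0 k0 ek.
have q0 : (0 < k %/ e)%N by rewrite (divn_gt0 k e0) dvdn_leq.
by have := @leq_pmul2l _ e N q0; rewrite (divnK ek) => <-.
Qed.

(** Since A_i is the series of m q^(im), it contributes k/i to the coefficient of q^k when i divides
    k. *)
Lemma coef_sigma k N : (0 < k)%N -> (sigma k N)%:Z = lams N k.
Proof.
move=> k0; rewrite /lambert_sum coef_fps_sum -sum_divisors_le //.
rewrite (big_morph Posz PoszD erefl) [LHS]big_mkcond.
by apply: eq_bigr => i _; rewrite -geom_id coef_geom.
Qed.

Lemma coef0_lambert_sum N : lams N 0%N = 0.
Proof.
rewrite /lambert_sum coef_fps_sum big1 // => i _.
by rewrite -geom_id coef_geom div0n dvdn0.
Qed.

(** Only values m in the finite image of [A] contribute, and on the fiber over m the factor m^k is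
    [g x ^+ k]. *)
Lemma fsum_fiber_moment (T : choiceType) (A : set T) (g : T -> int)
    (F : T -> int) k : finite_set A ->
  \sum_(m \in [set: int]) m ^+ k * \sum_(x \in A `&` g @^-1` [set m]) F x =
  \sum_(x \in A) g x ^+ k * F x.
Proof.
move=> finA; rewrite (@fsbig_fibers _ _ A (g @` A) g) //; last first.
  exact: finite_image.
rewrite -(@fsbig_widen _ _ _ _ (g @` A)) //; last first.
  move=> m [_ /= mA]; rewrite fsbig1 ?mulr0 // => x [Ax /= gx].
  by case: mA; exists x.
apply: eq_fsbigr => m _; rewrite mulr_fsumr; apply: eq_fsbigr => x.
by rewrite inE => -[_ /= ->].
Qed.

Lemma fsum_exchange_big (K : choiceType) (r : seq nat) (G : nat -> K -> int) :
    (forall j, finite_set [set m | G j m != 0]) ->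
  \sum_(m \in [set: K]) \sum_(j <- r) G j m =
  \sum_(j <- r) \sum_(m \in [set: K]) G j m.
Proof.
move=> fin; pose B := \bigcup_(j in [set` r]) [set m | G j m != 0].
have finB : finite_set B by apply: bigcup_finite => // ; exact: finite_seq.
have G0 j m : j \in r -> ~ B m -> G j m = 0.
  by move=> jr Bm; apply/eqP; apply: contrapT => /negP h; apply: Bm; exists j.
rewrite -(@fsbig_widen _ _ _ _ B) //; last first.
  by move=> m [_ Bm] /=; rewrite big_seq big1 // => j jr; exact: G0.
rewrite fsbig_finite // exchange_big big_seq [RHS]big_seq; apply: eq_bigr => j jr.
rewrite -(@fsbig_widen _ _ _ _ B) // ?fsbig_finite // => m [_ Bm].
exact: G0.
Qed.

Lemma S1E N j m n : S1 N j m n =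
  (distinct_part (N - j) N `*` durfee_part j
     `&` (fun x => sumn x.1 + sumn x.2)%N @^-1` [set n])
  `&` (fun x => rank x.2) @^-1` [set m].
Proof.
apply/seteqP; split => -[s t]; rewrite /S1 /distinct_part /durfee_part /=.
  by move=> [[/andP[-> _] -> ->] [-> -> -> ->]]; rewrite eqxx.
move=> [[[/and3P[ss us sN] /andP[-> /eqP ->]] ->] ->]; split => //.
split => //; rewrite /is_partition ss /=.
by apply/negP => /(allP sN).
Qed.

Lemma finite_fibers_durfee j : finite_fibers (durfee_part j) sumn.
Proof.
move=> n; apply: sub_finite_set (finite_partitions_sumn_le n) => s.
by move=> [/andP[ps _] /= sn]; rewrite ps sn leqnn.
Qed.

Lemma coef_rank_moment N n : rank_moment 2 N n =
  (\sum_(j < N.+1) qp N * qv (N - j) * fpsX ^+ (j ^ 2)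
                   * (qv j ^+ 2 * lams j)) n *+ 2.
Proof.
rewrite /rank_moment /N_S1; under eq_fsbigr do rewrite mulr_sumr.
rewrite fsum_exchange_big => [|j]; last first.
  apply: sub_finite_set (finite_image (fun x => rank x.2) (finite_S1_all N j n)).
  move=> m /= hm; apply: contrapT => hn; case/negP: hm; apply/eqP.
  rewrite fsbig1 ?mulr0 // => x hx; case: hn; exists x; first by exists m.
  by case: hx => _ [].
(* The moment starts at j = 1; on the other side the term j = 0 vanishes because [lams 0] is an
   empty sum. *)
rewrite big_ord_recl /= {1}/lambert_sum big_ord0 !mulr0 add0r.
rewrite coef_fps_sum -sumrMnl big_add1 /= big_mkord; apply: eq_bigr => i _.
set j := i.+1; have jN : (j <= N)%N := ltn_ord i.
rewrite /bump /= add1n -/j.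
have finX :=
  finite_fibersX (@finite_fibers_distinct (N - j) N) (@finite_fibers_durfee j).
under eq_fsbigr do rewrite S1E.
rewrite fsum_fiber_moment; last exact: finX.
transitivity (gf (distinct_part (N - j) N `*` durfee_part j)
  (fun x => sumn x.1 + sumn x.2)%N
  (tensor (fun s => (-1) ^+ size s) (fun s => rank s ^+ 2)) n).
  by apply: eq_fsbigr => x _; rewrite mulrC.
rewrite gfX; [|exact: finite_fibers_distinct|exact: finite_fibers_durfee].
rewrite gf_durfee_rank // -{2}(subnK jN) gf_distinct subnK //.
by rewrite mulrA mulrnAr coef_fpsMn.
Qed.

Lemma coef_crank_moment N n :
  crank_moment 2 N n = (qv N * lams N) n *+ 2.
Proof.
pose E := distinct_part 0 N `*` part_le N `*` part_le N.
pose w (x : seq nat * seq nat * seq nat) := (sumn x.1.1 + sumn x.1.2 + sumn x.2)%N.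
pose g (x : seq nat * seq nat * seq nat) := (size x.1.2)%:Z - (size x.2)%:Z.
have S2E m : S2 N m n = E `&` w @^-1` [set n] `&` g @^-1` [set m].
  have DE s : distinct_part 0 N s <->
      [/\ is_partition s, uniq s & (largest s <= N)%N].
    rewrite /distinct_part /=; split.
      move=> /and3P[ss us sN].
      have : is_partition s && (largest s <= N)%N by rewrite is_partition_largest ss.
      by case/andP.
    move=> [ps -> lN]; have := is_partition_largest N s.
    by rewrite ps lN /= => /esym.
  apply/seteqP; split => -[[a b] c]; rewrite /S2 /E /w /g /part_le /=.
    move=> [[pa ua -> ->] [[la -> ->] [-> ->]]]; do !split => //.
    exact/DE.
  by move=> [[[[/DE[pa ua la] /andP[-> ->]] /andP[-> ->]] ->] ->].
have [finP _ _ _] := part_le_moments N.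
have finD := @finite_fibers_distinct 0 N.
have finE : finite_fibers E w := finite_fibersX (finite_fibersX finD finP) finP.
rewrite /crank_moment /M_S2; under eq_fsbigr do rewrite S2E.
rewrite fsum_fiber_moment; last exact: finE.
transitivity (gf E w (fun x => g x ^+ 2 * (-1) ^+ size x.1.1) n); first by [].
(* Regrouping the triple separates the signed component from the pair that carries the crank. *)
pose h (x : seq nat * (seq nat * seq nat)) := (x.1, x.2.1, x.2.2).
rewrite (@gf_bij _ _ (distinct_part 0 N `*` (part_le N `*` part_le N)) _ h
  (fun x => sumn x.1 + (sumn x.2.1 + sumn x.2.2))%N _
  (tensor (fun s => (-1) ^+ size s)
          (fun y => ((size y.1)%:Z - (size y.2)%:Z) ^+ 2))).
(* The signed component contributes [qp N], which cancels one of the two factors [qv N] given by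
   [gf_diff_sqr]. *)
- rewrite (gfX _ _ finD (finite_fibersX finP finP)).
  rewrite (gf_diff_sqr (part_le_moments N) (part_le_moments N)).
  have := gf_distinct 0 N; rewrite add0n => ->.
  have -> : qv 0 = 1 by rewrite /inv_qpoch big_ord0.
  rewrite mulr1 mulrnAr expr2 !mulrA.
  rewrite qpochK; last exact: geom1P.
  by rewrite mul1r coef_fpsMn.
- split.
  + by move=> [a [b c]] [/= ? [? ?]].
  + by move=> [a [b c]] [a' [b' c']] _ _ [-> -> ->].
  + by move=> [[a b] c] [[/= ? ?] ?]; exists (a, (b, c)).
- by move=> [a [b c]] _; rewrite /w /= addnA.
- by move=> [a [b c]] _; rewrite /tensor /g /= mulrC.
Qed.

Lemma coef_crank_sigma N n : (0 < n)%N -> (qv N * lams N) n =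
  (\sum_(0 <= j < n) num_part j N * sigma (n - j) N)%N%:Z.
Proof.
(* The convolution runs up to j = n, but its last term contains the zero constant coefficient of
   [lams N]. *)
move=> n0; rewrite coef_fpsM big_ord_recr /= subnn coef0_lambert_sum.
rewrite mulr0 addr0 big_mkord (big_morph Posz PoszD erefl).
by apply: eq_bigr => i _; rewrite PoszM coef_num_part coef_sigma ?subn_gt0.
Qed.

(** The identity is doubled to stay within the integers; it is [spt_rank_identity] read off at
    q^n. *)
Lemma coef_spt_rank N n : (spt n N)%:Z *+ 2 =
  (qv N * lams N) n *+ 2 - rank_moment 2 N n.
Proof.
rewrite coef_rank_moment coef_spt.
rewrite (spt_rank_identity geom1P gf_smallest0 gf_smallestS).
by rewrite coef_fpsD coef_fpsN mulrnBl.
Qed.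

Theorem theorem2p4 (N n : nat) (n_gt0 : (0 < n)%N) :
  ((spt n N)%:R = (crank_moment 2 N n - rank_moment 2 N n)%:~R / 2%:R :> rat)
  /\
  ((spt n N)%:R = (\sum_(0 <= j < n) num_part j N * sigma (n - j) N)%N%:R
                  - (rank_moment 2 N n)%:~R / 2%:R :> rat).
Proof.
have two0 : (2%:R : rat) != 0 by [].
have key : (spt n N)%:R * 2%:R =
    (\sum_(0 <= j < n) num_part j N * sigma (n - j) N)%N%:R * 2%:R
    - (rank_moment 2 N n)%:~R :> rat.
  have := coef_spt_rank N n; rewrite coef_crank_sigma //.
  move=> /(congr1 (intr : int -> rat)).
  by rewrite rmorphB !rmorphMn /= !mulr_natr.
have crank : (crank_moment 2 N n)%:~R =
    (\sum_(0 <= j < n) num_part j N * sigma (n - j) N)%N%:R * 2%:R :> rat.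
  by rewrite coef_crank_moment coef_crank_sigma // rmorphMn mulr_natr.
split; last by rewrite -[LHS](mulfK two0) key mulrBl mulfK.
by rewrite -[LHS](mulfK two0) key rmorphB /= crank.
Qed.
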